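(* Let $G$ be a (crown, fork)-free graph. Then $\chi(G)\le \frac{1}{2}\left(\omega^2(G)+\omega(G)\right)$.
   Context: All graphs are finite and simple. $\chi(G)$ is the chromatic number and $\omega(G)$ the clique number of $G$; $\omega^2(G)$ means $(\omega(G))^2$. The crown is the graph $K_1+K_{1,3}$, i.e. the claw $K_{1,3}$ together with a new vertex adjacent to all four vertices of $K_{1,3}$. The fork is the graph obtained from $K_{1,3}$ by subdividing one edge once. A graph is $(F_1,F_2)$-free if it has no induced subgraph isomorphic to $F_1$ or to $F_2$. *)

(* Defs.v *)
From mathcomp Require Import all_boot.

Set Implicit Arguments.
Unset Strict Implicit.
Unset Printing Implicit Defensive.

Record sgraph := SGraph {
  vertex :> finType;
  adj : rel vertex;
  adj_sym : symmetric adj;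
  adj_irr : irreflexive adj
}.

Definition colorable (G : sgraph) (k : nat) : bool :=
  [exists c : {ffun G -> 'I_k},
    [forall x, forall y, adj x y ==> (c x != c y)]].

Lemma colorable_exists (G : sgraph) : exists k, colorable G k.
Proof.
exists #|G|; apply/existsP; exists [ffun x => enum_rank x].
apply/forallP => x; apply/forallP => y; apply/implyP => xy.
by rewrite !ffunE; apply: contraTneq xy => /enum_rank_inj ->; rewrite adj_irr.
Qed.

Definition chromatic_number (G : sgraph) : nat := ex_minn (colorable_exists G).

Definition is_clique (G : sgraph) (A : {set G}) : bool :=
  [forall x in A, forall y in A, (x != y) ==> adj x y].

Definition clique_number (G : sgraph) : nat :=
  \max_(A : {set G} | is_clique A) #|A|.

Section Induced.
Variables (G : sgraph) (A : {set G}).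

Definition induced_adj : rel {x : G | x \in A} :=
  fun u v => adj (val u) (val v).

Lemma induced_adj_sym : symmetric induced_adj.
Proof. by move=> u v; apply: adj_sym. Qed.

Lemma induced_adj_irr : irreflexive induced_adj.
Proof. by move=> u; apply: adj_irr. Qed.

Definition induced : sgraph := SGraph induced_adj_sym induced_adj_irr.
End Induced.

Definition isomorphic (G H : sgraph) : Prop :=
  exists2 f : G -> H, bijective f & forall x y, adj (f x) (f y) = adj x y.

Definition is_free (F G : sgraph) : Prop :=
  forall A : {set G}, ~ isomorphic (induced A) F.

Section Complete.
Variable n : nat.

Definition complete_adj : rel 'I_n := fun i j => i != j.

Lemma complete_adj_sym : symmetric complete_adj.
Proof. by move=> i j; rewrite /complete_adj eq_sym. Qed.

Lemma complete_adj_irr : irreflexive complete_adj.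
Proof. by move=> i; rewrite /complete_adj eqxx. Qed.

Definition complete : sgraph := SGraph complete_adj_sym complete_adj_irr.
End Complete.

Section CompleteBipartite.
Variables m n : nat.

Definition bipartite_adj : rel ('I_m + 'I_n) := fun u v =>
  match u, v with
  | inl _, inr _ | inr _, inl _ => true
  | _, _ => false
  end.

Lemma bipartite_adj_sym : symmetric bipartite_adj.
Proof. by case=> i [] j. Qed.

Lemma bipartite_adj_irr : irreflexive bipartite_adj.
Proof. by case. Qed.

Definition complete_bipartite : sgraph :=
  SGraph bipartite_adj_sym bipartite_adj_irr.
End CompleteBipartite.

Section Join.
Variables G H : sgraph.

Definition join_adj : rel (G + H) := fun u v =>
  match u, v with
  | inl x, inl y => adj x y
  | inr x, inr y => adj x y
  | _, _ => true
  end.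

Lemma join_adj_sym : symmetric join_adj.
Proof. by case=> x [] y //=; apply: adj_sym. Qed.

Lemma join_adj_irr : irreflexive join_adj.
Proof. by case=> x /=; apply: adj_irr. Qed.

Definition join : sgraph := SGraph join_adj_sym join_adj_irr.
End Join.

(* Subdivision of the edge ab: the edge ab is removed and the new vertex None
   is made adjacent to exactly a and b.  Only meaningful when adj a b holds. *)
Section Subdivide.
Variables (G : sgraph) (a b : G).

Definition subdivide_adj : rel (option G) := fun u v =>
  match u, v with
  | Some x, Some y => adj x y && ([set x; y] != [set a; b])
  | Some x, None | None, Some x => x \in [set a; b]
  | None, None => false
  end.

Lemma subdivide_adj_sym : symmetric subdivide_adj.
Proof. by case=> [x|] [y|] //=; rewrite adj_sym setUC. Qed.

Lemma subdivide_adj_irr : irreflexive subdivide_adj.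
Proof. by case=> [x|] //=; rewrite adj_irr. Qed.

Definition subdivide : sgraph := SGraph subdivide_adj_sym subdivide_adj_irr.
End Subdivide.

Definition claw : sgraph := complete_bipartite 1 3.

Definition crown : sgraph := join (complete 1) claw.

Definition fork : sgraph :=
  @subdivide claw (inl ord0) (inr ord0).

(* Main.v *)
Require Import Defs.
From mathcomp Require Import all_boot all_order all_algebra.
From mathcomp Require Import zify.
Import Order.TTheory GRing.Theory Num.Theory.

Set Implicit Arguments.
Unset Strict Implicit.
Unset Printing Implicit Defensive.

(** The bound is the sum 1 + 2 + ... + omega = 'C(omega + 1, 2), obtained by
    peeling off one layer at a time.  Let A be a set of vertices whose cliques
    have at most m + 1 elements.  The neighbours of a vertex v of A have
    cliques of size at most m, so 'C(m + 1, 2) colours suffice for them by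
    induction, and the m + 1 further colours of 'C(m + 2, 2) have to colour the
    set [far] of the non-neighbours of v, v itself included.  The point is
    that v can be chosen to make this possible.

    If some u in A is not the centre of a claw, its neighbourhood has no
    stable triple, hence fewer than 'C(m + 2, 2) vertices, by the bound on the
    Ramsey numbers R(3, m + 1) ([Ramsey3]); then u can be coloured last.  So
    every vertex of A may be assumed to be the centre of a claw, and v is
    taken to be the centre of a largest induced star, with set of leaves I.

    - Excluding forks, a vertex of [far] misses all of I (it is [remote]), or
      at most one leaf ([far_missed]).
    - Two adjacent remote vertices c and c' have the same neighbours outside
      [remote].  As c is the centre of a claw and crowns are excluded, c then
      has no neighbour outside [remote] at all, and such vertices form a union
      of components that can be coloured separately.  So [remote] may be
      assumed to be stable.
    - Let T be the set of the vertices of [far] that miss exactly one leaf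
      ([near_miss]).  Those missing the same leaf form a clique, and
      non-adjacency is transitive between vertices that miss different leaves.
      This is enough for T to be coloured with as many colours as a largest
      clique Q of T has vertices ([set_colorable_parts]).
    - The rest Z of [far] is stable, because the star is largest and crowns
      are excluded, and a vertex of Z is adjacent to both or to neither of two
      non-adjacent vertices of T ([rest_agree]).  Given z in Z, if some w in Q
      is not adjacent to z, then w is adjacent to all the neighbours of z in T,
      so that the colour of w is free for z.  Otherwise Q together with z is a
      clique, and one of the m + 1 colours is not used on T at all. *)

Local Open Scope nat_scope.

(** * Forbidden induced subgraphs as forbidden adjacency patterns *)

Lemma no_induced_copy (F G : sgraph) (h : F -> G) :
  injective h -> (forall x y, adj (h x) (h y) = adj x y) -> ~ is_free F G.
Proof.
move=> inj_h hE freeF; pose A := h @: [set: F].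
have hA x : h x \in A by rewrite imset_f ?inE.
pose g (x : F) : induced A := exist (fun y => y \in A) (h x) (hA x).
have inj_g : injective g by move=> x y /(congr1 val) /inj_h.
have surj_g u : exists x, g x == u.
  case: u => y yA; have /imsetP[x _ def_y] := yA.
  by exists x; apply/eqP/val_inj; rewrite /= def_y.
pose f u := xchoose (surj_g u).
have fK : cancel f g by move=> u; apply/eqP/(xchooseP (surj_g u)).
have gK : cancel g f by move=> x; apply: inj_g; rewrite fK.
apply: (freeF A); exists f; first by exists g.
by move=> x y; rewrite -{2}(fK x) -{2}(fK y) -hE.
Qed.

Definition apart (G : sgraph) (x y : G) := (x != y) && ~~ adj x y.

Lemma apart_sym (G : sgraph) : symmetric (@apart G).
Proof. by move=> x y; rewrite /apart eq_sym adj_sym. Qed.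

Definition stable (G : sgraph) (S : {set G}) :=
  [forall x in S, forall y in S, ~~ adj x y].

Lemma stableP (G : sgraph) (S : {set G}) :
  reflect {in S &, forall x y, ~~ adj x y} (stable S).
Proof.
apply: (iffP forall_inP) => [h x y xS yS|h x xS].
  by have /forall_inP := h x xS; apply.
by apply/forall_inP => y yS; apply: h.
Qed.

Lemma cliqueP (G : sgraph) (Q : {set G}) :
  reflect {in Q &, forall x y, x != y -> adj x y} (is_clique Q).
Proof.
apply: (iffP forall_inP) => [h x y xS yS|h x xS].
  by have /forall_inP/(_ _ yS)/implyP := h x xS; apply.
by apply/forall_inP => y yS; apply/implyP; apply: h.
Qed.

Section ForbiddenSubgraphs.

Variable G : sgraph.
Implicit Types (u v a b c d : G) (I : {set G}).


Lemma no_crown u v a b c : is_free crown G ->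
  adj u v -> adj u a -> adj u b -> adj u c -> adj v a -> adj v b -> adj v c ->
  apart a b -> apart a c -> apart b c -> False.
Proof.
move=> crown_free uv ua ub uc va vb vc.
move=> /andP[ab /negbTE nab] /andP[ac /negbTE nac] /andP[bc /negbTE nbc].
pose h (x : crown) : G := match x with
  | inl _ => u | inr (inl _) => v | inr (inr i) => nth a [:: a; b; c] i end.
have hE x y : adj (h x) (h y) = adj x y.
  move: x y => [i|[i|[[|[|[|//]]] ?]]] [j|[j|[[|[|[|//]]] ?]]] //=;
  rewrite ?adj_irr /complete_adj ?(ord1 i) ?(ord1 j) ?eqxx //;
  by [assumption | rewrite adj_sym].
apply: (no_induced_copy _ hE crown_free) => x y.
have neq w z : adj w z -> (w == z) = false.
  by move=> wz; apply: contraTF wz => /eqP->; rewrite adj_irr.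
have neq' w z : adj w z -> (z == w) = false by move=> /neq; rewrite eq_sym.
move: x y => [i|[i|[[|[|[|//]]] ?]]] [j|[j|[[|[|[|//]]] ?]]] /= /eqP;
  do ?[by rewrite neq | by rewrite neq' | by rewrite (negbTE ab)
      | by rewrite (negbTE ac) | by rewrite (negbTE bc)
      | by rewrite eq_sym (negbTE ab) | by rewrite eq_sym (negbTE ac)
      | by rewrite eq_sym (negbTE bc)] => _;
  rewrite ?(ord1 i) ?(ord1 j) //; congr (inr (inr _)); exact: val_inj.
Qed.

Lemma no_fork v a b c d : is_free fork G ->
  adj v a -> adj v b -> adj v c -> apart a b -> apart a c -> apart b c ->
  ~~ adj v d -> adj a d -> ~~ adj b d -> ~~ adj c d -> False.
Proof.
move=> fork_free va vb vc.
move=> /andP[ab /negbTE nab] /andP[ac /negbTE nac] /andP[bc /negbTE nbc].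
move=> /negbTE nvd ad /negbTE nbd /negbTE ncd.
pose h (x : fork) : G := match x with
  | None => a | Some (inl _) => v
  | Some (inr i) => nth a [:: d; b; c] i end.
have hE x y : adj (h x) (h y) = adj x y.
  move: x y => [[i|[[|[|[|//]]] ?]]|] [[j|[[|[|[|//]]] ?]]|] //=;
  rewrite ?adj_irr ?(ord1 i) ?(ord1 j) ?eqEsubset ?subUset ?sub1set ?inE //=;
  by [assumption | rewrite adj_sym].
have neq w z : adj w z -> (w == z) = false.
  by move=> wz; apply: contraTF wz => /eqP->; rewrite adj_irr.
have neq' w z : adj w z -> (z == w) = false by move=> /neq; rewrite eq_sym.
have vd : v != d by apply: contraTneq vb => ->; rewrite adj_sym nbd.
have bd : b != d by apply: contraTneq ad => <-; rewrite nab.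
have cd : c != d by apply: contraTneq ad => <-; rewrite nac.
apply: (no_induced_copy _ hE fork_free) => x y.
move: x y => [[i|[[|[|[|//]]] ?]]|] [[j|[[|[|[|//]]] ?]]|] /= /eqP;
  do ?[by rewrite neq | by rewrite neq' | by rewrite (negbTE ab)
      | by rewrite (negbTE ac) | by rewrite (negbTE bc) | by rewrite (negbTE vd)
      | by rewrite (negbTE bd) | by rewrite (negbTE cd)
      | by rewrite eq_sym (negbTE ab) | by rewrite eq_sym (negbTE ac)
      | by rewrite eq_sym (negbTE bc) | by rewrite eq_sym (negbTE vd)
      | by rewrite eq_sym (negbTE bd) | by rewrite eq_sym (negbTE cd)] => _;
  rewrite ?(ord1 i) ?(ord1 j) //; congr (Some (inr _)); exact: val_inj.
Qed.

End ForbiddenSubgraphs.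

(** * Colouring a set of vertices *)

Section Colouring.

Variable G : sgraph.
Implicit Types (A B K Q S T U I : {set G}) (u v w x y z : G).

Definition set_colorable A k := exists c : G -> nat,
  {in A, forall x, c x < k} /\ {in A &, forall x y, adj x y -> c x != c y}.

Definition cliques_le A m :=
  forall Q, Q \subset A -> is_clique Q -> #|Q| <= m.

Lemma cliques_leS A B m : B \subset A -> cliques_le A m -> cliques_le B m.
Proof. by move=> BA leA Q QB; apply: leA; apply: subset_trans BA. Qed.

Lemma cliqueS Q K : K \subset Q -> is_clique Q -> is_clique K.
Proof.
move=> /subsetP KQ /cliqueP clQ; apply/cliqueP => x y /KQ xQ /KQ yQ.
exact: clQ.
Qed.

Lemma clique1 x : is_clique [set x].
Proof.
by apply/cliqueP => y z /set1P-> /set1P->; rewrite eqxx.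
Qed.

Lemma cliqueU Q K : is_clique Q -> is_clique K ->
  (forall x y, x \in Q -> y \in K -> x != y -> adj x y) -> is_clique (Q :|: K).
Proof.
move=> /cliqueP clQ /cliqueP clK QK.
apply/cliqueP => x y /setUP[xQ|xK] /setUP[yQ|yK] xy; auto.
by rewrite adj_sym; apply: QK => //; rewrite eq_sym.
Qed.

Lemma maximum_clique A :
  exists2 Q, is_clique Q /\ Q \subset A & cliques_le A #|Q|.
Proof.
pose P Q := is_clique Q && (Q \subset A).
have P0 : P set0 by rewrite /P sub0set andbT; apply/cliqueP => x y; rewrite inE.
case: (@arg_maxnP _ set0 P (fun Q => #|Q|) P0) => Q /andP[clQ QA] maxQ.
by exists Q => // K KA clK; apply: maxQ; rewrite /P clK.
Qed.

Lemma set_colorable_leq A k l : k <= l ->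
  set_colorable A k -> set_colorable A l.
Proof.
move=> kl [c [c_lt c_adj]]; exists c; split=> // x /c_lt xk.
exact: leq_trans kl.
Qed.

Lemma set_colorableS A B k : B \subset A ->
  set_colorable A k -> set_colorable B k.
Proof.
move=> /subsetP BA [c [c_lt c_adj]]; exists c.
by split=> [x /BA/c_lt //|x y /BA xA /BA yA]; apply: c_adj.
Qed.

Lemma set_colorableU A B k l : set_colorable A k -> set_colorable B l ->
  set_colorable (A :|: B) (k + l).
Proof.
move=> [c [c_lt c_adj]] [d [d_lt d_adj]].
exists (fun x => if x \in A then c x else k + d x); split=> [x|x y].
  case: ifPn => [/c_lt xk _|/negPf xA]; first exact: ltn_addr.
  by rewrite inE xA ltn_add2l; apply: d_lt.
rewrite !inE; case: ifPn => /= xA; case: ifPn => /= yA.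
- by move=> _ _; apply: c_adj.
- by move=> _ _ _; apply: contraTneq (c_lt x xA) => ->;
  rewrite -leqNgt leq_addr.
- by move=> _ _ _; apply: contraTneq (c_lt y yA) => <-;
  rewrite -leqNgt leq_addr.
by rewrite eqn_add2l; apply: d_adj.
Qed.

Lemma set_colorable_disconnected A B k :
  {in A & B, forall x y, ~~ adj x y} ->
  set_colorable A k -> set_colorable B k -> set_colorable (A :|: B) k.
Proof.
move=> AB [c [c_lt c_adj]] [d [d_lt d_adj]].
exists (fun x => if x \in A then c x else d x); split=> [x|x y].
  by rewrite inE; case: ifPn => [/c_lt|_ /d_lt].
rewrite !inE; case: ifPn => /= xA; case: ifPn => /= yA.
- by move=> _ _; apply: c_adj.
- by move=> _ yB; rewrite (negPf (AB _ _ _ _)).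
- by move=> xB _; rewrite adj_sym (negPf (AB _ _ _ _)).
exact: d_adj.
Qed.

Lemma set_colorable_stable S : stable S -> set_colorable S 1.
Proof.
move=> /stableP stS; exists (fun=> 0); split=> // x y xS yS xy.
by have := stS x y xS yS; rewrite xy.
Qed.

Lemma set_colorable_card A : set_colorable A #|A|.
Proof.
exists (fun x => index x (enum A)); split=> [x xA|x y xA yA].
  by rewrite cardE index_mem mem_enum.
apply: contraTneq => eq_xy; have := congr1 (nth x (enum A)) eq_xy.
by rewrite !nth_index ?mem_enum // => ->; rewrite adj_irr.
Qed.

(** The vertices of S are coloured independently of each other, so it is
    enough that each of them finds a colour unused by its neighbours in A. *)
Lemma set_colorable_extend A S k (c : G -> nat) :
  {in A, forall x, c x < k} -> {in A &, forall x y, adj x y -> c x != c y} ->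
  stable S ->
  {in S, forall z, exists2 i, i < k & {in A, forall x, adj z x -> c x != i}} ->
  set_colorable (A :|: S) k.
Proof.
move=> c_lt c_adj /stableP stS freeS.
have [d dP] : exists d : G -> nat, forall z, z \in S ->
    d z < k /\ {in A, forall x, adj z x -> c x != d z}.
  pose P z i := z \in S -> i < k /\ {in A, forall x, adj z x -> c x != i}.
  apply: (@fin_all_exists _ _ P) => z; rewrite /P.
  case: (boolP (z \in S)) => [/freeS[i ik iP]|_].
    by exists i.
  by exists 0.
exists (fun x => if x \in S then d x else c x); split=> [x|x y].
  rewrite inE; case: ifPn => [/dP[] //|_]; rewrite orbF; exact: c_lt.
rewrite !inE; case: ifPn => xS; case: ifPn => yS; rewrite ?orbT ?orbF => xA yA.
- by rewrite (negPf (stS _ _ _ _)).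
- by move=> xy; rewrite eq_sym; apply: (dP x xS).2.
- by move=> xy; apply: (dP y yS).2; rewrite // adj_sym.
exact: c_adj.
Qed.

Lemma unused_color (s : seq nat) k : size s < k ->
  exists2 i, i < k & i \notin s.
Proof.
move=> s_lt; have [/allP s_all|/allPn[i]] := boolP (all (mem s) (iota 0 k)).
  by have := uniq_leq_size (iota_uniq 0 k) s_all; rewrite size_iota leqNgt s_lt.
by rewrite mem_iota => ik iNs; exists i.
Qed.

Lemma set_colorable_small_degree A u k : u \in A ->
  #|[set x in A | adj u x]| < k ->
  set_colorable (A :\ u) k -> set_colorable A k.
Proof.
move=> uA deg_lt [c [c_lt c_adj]].
rewrite -(setD1K uA) setUC; apply: (set_colorable_extend c_lt c_adj).
  by apply/stableP => x y /set1P-> /set1P->; rewrite adj_irr.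
move=> z /set1P->.
have [|i ik iNs] := @unused_color [seq c x | x in [set x in A | adj u x]] k.
  by rewrite size_map -cardE.
exists i => // x /setD1P[_ xA] ux; apply: contraNneq iNs => <-.
by apply: map_f; rewrite mem_enum inE xA.
Qed.

(** The classical recursion for R(3, m + 1): the non-neighbours of a vertex
    form a clique, and its neighbours have smaller cliques. *)
Lemma Ramsey3 m B : (forall I, I \subset B -> stable I -> #|I| <= 2) ->
  cliques_le B m -> #|B| < 'C(m.+2, 2).
Proof.
elim: m B => [|m IHm] B al2 cl.
  have -> : B = set0; last by rewrite cards0.
  apply/setP => x; rewrite inE; apply/negP => xB.
  by have := cl [set x] _ (clique1 x); rewrite sub1set cards1 => /(_ xB).
have [->|[a aB]] := set_0Vmem B; first by rewrite cards0 bin_gt0.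
pose N := [set x in B | adj a x]; pose K := [set x in B | apart a x].
have NB : N \subset B by apply/subsetP => x; rewrite inE => /andP[].
have KB : K \subset B by apply/subsetP => x; rewrite inE => /andP[].
have BE : B \subset [set a] :|: K :|: N.
  apply/subsetP => x xB; rewrite !inE xB /apart /= [x == a]eq_sym.
  by case: eqP; case: (adj a x).
have cardK : #|K| <= m.+1.
  apply: cl => //; apply/cliqueP => x y; rewrite !inE.
  move=> /andP[xB /andP[ax nax]].
  move=> /andP[yB /andP[ay nay]] xy; apply: contraT => nxy.
  have /al2 : [set a; x; y] \subset B by rewrite !subUset !sub1set aB xB.
  rewrite -setUA !cardsU1 cards1 !inE negb_or ax ay xy /= => al2'.
  apply: al2'; apply/stableP => s t; rewrite !inE.
  move=> /or3P[] /eqP-> /or3P[] /eqP->;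
    by rewrite ?adj_irr // adj_sym.
have cardN : #|N| < 'C(m.+2, 2).
  apply: IHm => [I IN|Q QN clQ]; first by apply: al2; apply: subset_trans NB.
  have aQ : a \notin Q.
    by apply/negP => /(subsetP QN); rewrite inE adj_irr andbF.
  suff: #|a |: Q| <= m.+1 by rewrite cardsU1 aQ.
  apply: cl.
    by rewrite subUset sub1set aB (subset_trans QN).
  apply: cliqueU => // [|x y /set1P-> /(subsetP QN)]; first exact: clique1.
  by rewrite inE => /andP[].
apply: (leq_ltn_trans (subset_leq_card BE)).
apply: (leq_ltn_trans (leq_card_setU _ _)).
rewrite binS bin1 -addnS [leqRHS]addnC leq_add //.
apply: leq_trans (leq_card_setU _ _) _.
by rewrite cards1 add1n ltnS.
Qed.

End Colouring.

(** * Graphs coloured with as many colours as a largest clique needs *)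

Section PerfectPieces.

Variable G : sgraph.
Implicit Types (A B K Q S T U : {set G}) (u v w x y z : G).

(** The usual step towards chi = omega: a stable set that meets every largest
    clique takes one colour and lowers the clique number by one. *)
Lemma set_colorable_hit A S m : S \subset A -> stable S -> cliques_le A m.+1 ->
  (forall Q, Q \subset A -> is_clique Q -> #|Q| = m.+1 -> Q :&: S != set0) ->
  (cliques_le (A :\: S) m -> set_colorable (A :\: S) m) -> set_colorable A m.+1.
Proof.
move=> SA stS leA hitS colA; rewrite -(setID A S) (setIidPr SA) setUC -addn1.
apply: set_colorableU; last exact: set_colorable_stable.
apply: colA => Q /subsetDP[QA disQS] clQ; rewrite -ltnS ltn_neqAle leA // andbT.
by apply/negP => /eqP/(hitS Q QA clQ); rewrite setI_eq0 disQS.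
Qed.

(** Complements of bipartite graphs have chi = omega, a form of König's
    theorem.  Let a in A and b in B be non-adjacent.  If every largest clique
    contains a or b, the pair can be given a colour of its own.  A largest
    clique Q avoiding both meets A as well as B \ A, since otherwise b or a
    could be added to it.  Then Q cuts the graph into A \ Q together with
    Q \ A, and Q :&: A together with B \ Q.  These are smaller graphs of the
    same kind, with clique numbers at most #|Q \ A| and #|Q :&: A|: a clique of
    the first together with Q :&: A is again a clique, and likewise for the
    second and Q \ A.  The two bounds add up to #|Q|. *)
Lemma Konig A B m : is_clique A -> is_clique B -> cliques_le (A :|: B) m ->
  set_colorable (A :|: B) m.
Proof.
have [n] := ubnP (#|A| + #|B|); elim: n A B m => // n IHn A B m.
rewrite ltnS => le_n clA clB le_m.
have [/existsP[a /andP[aA /existsP[b /andP[bB ab]]]]|noab] :=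
  boolP [exists a in A, exists b in B, apart a b]; last first.
  apply: set_colorable_leq (set_colorable_card _); apply: le_m => //.
  apply: cliqueU => // x y xA yB xy; apply: contraNT noab => nxy.
  apply/existsP; exists x; rewrite xA; apply/existsP; exists y.
  by rewrite yB /apart xy.
have /andP[a_b nab] := ab.
have [/existsP[Q]|noQ] := boolP [exists Q : {set G}, [&& Q \subset A :|: B,
    is_clique Q, #|Q| == m, a \notin Q & b \notin Q]].
  move=> /and5P[QAB clQ /eqP cardQ aQ bQ].
  have QE x : x \in Q -> x \notin A -> x \in B.
    by move=> /(subsetP QAB); rewrite inE => /orP[->|].
  have QD_B : Q :\: A \subset B.
    by apply/subsetP => x /setDP[]; apply: QE.
  have QA_n0 : 0 < #|Q :&: A|.
    rewrite card_gt0; apply: contraTneq isT => QA0.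
    suff: #|b |: Q| <= m by rewrite cardsU1 bQ cardQ ltnn.
    apply: le_m; last apply: cliqueS clB.
      by rewrite subUset sub1set inE bB orbT.
    rewrite subUset sub1set bB; apply/subsetP => x xQ; apply: QE => //.
    by apply: contra_eqN QA0 => xA; apply/set0Pn; exists x; rewrite inE xQ.
  have QB_n0 : 0 < #|Q :\: A|.
    rewrite card_gt0 setD_eq0; apply/negP => QA.
    suff: #|a |: Q| <= m by rewrite cardsU1 aQ cardQ ltnn.
    apply: le_m; first by rewrite subUset sub1set inE aA.
    by apply: cliqueS clA; rewrite subUset sub1set aA.
  have clAQ : is_clique (A :\: Q) by apply: cliqueS clA; apply: subsetDl.
  have clBQ : is_clique (B :\: Q) by apply: cliqueS clB; apply: subsetDl.
  have clQA : is_clique (Q :&: A) by apply: cliqueS clA; apply: subsetIr.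
  have clQB : is_clique (Q :\: A) by apply: cliqueS clB.
  have cardA := cardsID Q A; have cardB := cardsID Q B.
  have cardQA := cardsID A Q; rewrite [A :&: Q]setIC in cardA.
  have QD_BQ : #|Q :\: A| <= #|B :&: Q|.
    by rewrite subset_leq_card // subsetI QD_B subsetDl.
  have -> : A :|: B =
      ((A :\: Q) :|: (Q :\: A)) :|: ((Q :&: A) :|: (B :\: Q)).
    apply/setP => x; rewrite !inE.
    case: (boolP (x \in Q)) => [/(subsetP QAB)|_]; rewrite ?inE /=.
      by case: (x \in A) => //= ->.
    by rewrite andbF orbF.
  rewrite -cardQ -cardQA addnC; apply: set_colorableU; apply: IHn => //.
  - apply: leq_trans le_n; rewrite -cardA.
    by move: QA_n0 (subset_leq_card QD_B); clear; lia.
  - move=> K KS clK; suff: #|K :|: (Q :&: A)| <= m.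
      rewrite cardsU -cardQ -cardQA (_ : K :&: _ = set0) ?cards0.
        by rewrite subn0 addnC leq_add2l.
      apply/setP => x; rewrite !inE; apply/negP => /andP[/(subsetP KS)].
      by rewrite !inE; case: (x \in A); case: (x \in Q).
    apply: le_m.
      rewrite subUset (subset_trans KS) /=; last first.
        apply/subsetP => x; rewrite !inE => /orP[/andP[_ ->]//|/andP[xA xQ]].
        by rewrite (QE x) ?orbT.
      by rewrite subIset // subsetUl orbT.
    apply: cliqueU => // x y /(subsetP KS) xK /setIP[yQ yA].
    move: xK; rewrite !inE => /orP[]/andP[_ xin].
      by move/cliqueP: clA; apply.
    by move/cliqueP: clQ; apply.
  - apply: leq_trans le_n; rewrite -cardA -cardB.
    by move: QB_n0 QD_BQ; clear; lia.
  - move=> K KS clK; suff: #|K :|: (Q :\: A)| <= m.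
      rewrite cardsU -cardQ -cardQA (_ : K :&: _ = set0) ?cards0.
        by rewrite subn0 leq_add2r.
      apply/setP => x; rewrite !inE; apply/negP => /andP[/(subsetP KS)].
      by rewrite !inE; case: (x \in A); case: (x \in Q).
    apply: le_m.
      rewrite subUset (subset_trans KS) /=; last first.
        by apply/subsetP => x; rewrite !inE => /orP[/andP[_ ->]//|/andP[_ ->]];
          rewrite orbT.
      by apply: subset_trans (subsetUr _ _).
    apply: cliqueU => // x y /(subsetP KS) xK /setDP[yQ yA].
    move: xK; rewrite !inE => /orP[/andP[xin _]|/andP[_ xin]].
      by move/cliqueP: clQ; apply.
    by move/cliqueP: clB; apply => //; apply: QE.
have aNB : a \notin B.
  by apply: contra nab => aB; move/cliqueP: clB; apply.
have bNA : b \notin A.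
  by apply: contra nab => bA; move/cliqueP: clA; apply.
case: m le_m noQ => [|m] le_m noQ.
  by have := le_m _ _ (clique1 a); rewrite sub1set inE aA cards1 => /(_ isT).
have DE : (A :|: B) :\: [set a; b] = (A :\ a) :|: (B :\ b).
  apply/setP => x; rewrite !inE negb_or.
  case: eqP => [->|_] /=; first by rewrite (negPf aNB) andbF.
  by case: eqP => [->|//] /=; rewrite (negPf bNA).
apply: (@set_colorable_hit _ [set a; b]) => //.
- by rewrite subUset !sub1set !inE aA bB orbT.
- by apply/stableP => x y; rewrite !inE => /orP[]/eqP-> /orP[]/eqP->;
    rewrite ?adj_irr // adj_sym.
- move=> Q QAB clQ cardQ; apply/set0Pn.
  have /existsPn/(_ Q) := noQ; rewrite QAB clQ cardQ eqxx /= negb_and !negbK.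
  by case/orP => inQ; [exists a|exists b]; rewrite !inE inQ eqxx ?orbT.
rewrite DE; apply: IHn; first last.
- by apply: cliqueS clB; apply: subsetDl.
- by apply: cliqueS clA; apply: subsetDl.
by apply: leq_trans le_n; rewrite (cardsD1 a A) aA ltnS leq_add2l
  subset_leq_card // subsetDl.
Qed.

(** Completely joined sets need disjoint sets of colours, but their cliques
    also combine, so chi = omega passes to the join. *)
Lemma set_colorable_join A B m :
  {in A & B, forall x y, adj x y} -> cliques_le (A :|: B) m ->
  (forall k, cliques_le A k -> set_colorable A k) ->
  (forall k, cliques_le B k -> set_colorable B k) ->
  set_colorable (A :|: B) m.
Proof.
move=> AB le_m colA colB.
have [Q [clQ QA] maxQ] := maximum_clique A.
have [K [clK KB] maxK] := maximum_clique B.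
apply: set_colorable_leq (set_colorableU (colA _ maxQ) (colB _ maxK)).
have QK0 : Q :&: K = set0.
  apply/setP => x; rewrite !inE; apply/negP => /andP[/(subsetP QA) xA].
  by move=> /(subsetP KB) xB; have := AB x x xA xB; rewrite adj_irr.
have := cardsU Q K; rewrite QK0 cards0 subn0 => <-.
apply: le_m; first by rewrite setUSS.
by apply: cliqueU => // x y /(subsetP QA) xA /(subsetP KB) yB _; apply: AB.
Qed.

(** The values of p are the parts of T: the first hypothesis says that each
    part is a clique, the second one that non-adjacency is transitive across
    different parts.  If there is a stable triple, a maximal stable set S
    containing it meets every largest clique Q.  Indeed, if Q avoids S, every
    s in S is non-adjacent to some q in Q; by transitivity q is non-adjacent to
    all the elements of S outside its own part, and by maximality of S there is
    one element of S in that part.  Starting again from that element gives a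
    second vertex r of Q, in a part different from the one of q.  An element
    of S in neither part is non-adjacent to both q and r, so that q and r are
    non-adjacent, although both are in Q.  If there is no stable triple, T is
    the join of a graph covered by two cliques and of a smaller graph. *)
Lemma set_colorable_parts (P : eqType) (p : G -> P) T m :
  {in T &, forall x y, apart x y -> p x != p y} ->
  {in T & &, forall x y z,
    apart x y -> apart y z -> p x != p z -> apart x z} ->
  cliques_le T m -> set_colorable T m.
Proof.
have [n] := ubnP #|T|; elim: n T m => // n IHn T m.
rewrite ltnS => le_n parts trans le_m.
have IH U k : U \proper T -> cliques_le U k -> set_colorable U k.
  move=> UT; have /subsetP sUT := proper_sub UT; apply: IHn.
  - by apply: leq_trans (proper_card UT) le_n.
  - by move=> x y /sUT xT /sUT yT; apply: parts.
  by move=> x y z /sUT xT /sUT yT /sUT zT; apply: trans.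
have apart_p x y : x \in T -> y \in T -> x != y -> p x = p y -> adj x y.
  move=> xT yT xy pxy; apply: contraT => nxy.
  by have := parts x y xT yT; rewrite /apart xy nxy pxy eqxx => /(_ isT).
have [/existsP[S0 /and3P[S0T stS0 S0_gt2]]|noS] :=
  boolP [exists S : {set G}, [&& S \subset T, stable S & 2 < #|S|]].
  have [S /maxsetP[/andP[ST stS] maxS] S0S] :=
    @maxset_exists _ (fun S => (S \subset T) && stable S) S0
      (introT andP (conj S0T stS0)).
  have S_gt2 : 2 < #|S| := leq_trans S0_gt2 (subset_leq_card S0S).
  have /card_gt0P[s0 s0S] : 0 < #|S| by apply: leq_trans S_gt2.
  have s0T := subsetP ST _ s0S.
  have S_apart x y : x \in S -> y \in S -> x != y -> apart x y.
    by move=> xS yS xy; rewrite /apart xy; move/stableP: stS; apply.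
  case: m le_m => [|m] le_m.
    by have := le_m _ _ (clique1 s0); rewrite sub1set s0T cards1 => /(_ isT).
  apply: (@set_colorable_hit _ S) => //; last first.
    apply: IH; rewrite properEneq subsetDl andbT.
    by apply: contraTneq s0T => <-; rewrite inE s0S.
  move=> Q QT clQ cardQ; apply/negP => /eqP QS0.
  have QNS q : q \in Q -> q \notin S.
    by move=> qQ; apply/negP => qS; have /setP/(_ q) := QS0; rewrite !inE qQ qS.
  (* Otherwise s could be added to Q, which already has the largest size. *)
  have dominated s : s \in S -> exists2 q, q \in Q & apart q s.
    move=> sS; apply/exists_inP; apply: contraT => /exists_inPn noq.
    suff: #|s |: Q| <= m.+1.
      by rewrite cardsU1 cardQ (contraL (QNS s) sS) ltnn.
    apply: le_m; first by rewrite subUset sub1set (subsetP ST).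
    apply: cliqueU => // [|x q /set1P-> qQ sq]; first exact: clique1.
    have := noq q qQ; rewrite apart_sym /apart sq negbK; exact.
  have spread q s t : q \in Q -> s \in S -> t \in S -> apart q s ->
      p q != p t -> apart q t.
    move=> qQ sS tS qs qt; have [<-//|st] := eqVneq s t.
    apply: (trans q s t _ _ _ qs (S_apart _ _ sS tS st) qt);
      by [apply: (subsetP QT) | apply: (subsetP ST)].
  have same_part q s : q \in Q -> s \in S -> apart q s ->
      exists2 t, t \in S & p q = p t.
    move=> qQ sS qs; suff: [exists t in S, p q == p t].
      by move=> /exists_inP[t tS /eqP]; exists t.
    apply: contraT => /exists_inPn noT.
    have /negP[] := QNS q qQ; rewrite -(maxS (q |: S)) ?subsetUr ?setU11 //.
    rewrite subUset sub1set (subsetP QT) ?ST //=; apply/stableP => x y.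
    have qS t : t \in S -> ~~ adj q t.
      by move=> tS; have /andP[] := spread q s t qQ sS tS qs (noT t tS).
    move=> /setU1P[->|xS] /setU1P[->|yS]; rewrite ?adj_irr ?qS //.
      by rewrite adj_sym qS.
    by move/stableP: stS; apply.
  have [q qQ qs0] := dominated s0 s0S.
  have [s sS pqs] := same_part q s0 qQ s0S qs0.
  have [r rQ rs] := dominated s sS.
  have [t tS prt] := same_part r s rQ sS rs.
  have [[rT qT] [sT tT]] := ((subsetP QT r rQ, subsetP QT q qQ),
    (subsetP ST s sS, subsetP ST t tS)).
  have prs : p r != p s by apply: parts.
  have prq : p r != p q by rewrite pqs.
  have rq : r != q by apply: contraNneq prq => ->.
  have [w wS] : exists2 w, w \in S & w \notin [set s; t].
    apply/subsetPn; apply: contraL S_gt2 => /subset_leq_card.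
    by rewrite -leqNgt => /leq_trans->//; rewrite cards2; case: (_ != _).
  rewrite !inE negb_or => /andP[ws wt].
  have wT := subsetP ST w wS.
  have psw : p s != p w by apply: parts; rewrite // S_apart // eq_sym.
  have ptw : p t != p w by apply: parts; rewrite // S_apart // eq_sym.
  have qw : apart q w by apply: (spread q s0) => //; rewrite pqs.
  have rw : apart r w by apply: (spread r s) => //; rewrite prt.
  have /andP[_ /negP[]] : apart r q.
    by apply: (trans r w q); rewrite // apart_sym.
  by move/cliqueP: clQ; apply.
have no3 x y z : x \in T -> y \in T -> z \in T -> apart x y -> apart y z ->
    p x = p z.
  move=> xT yT zT xy yz; apply/eqP; apply: contraNT noS => pxz.
  have xz := trans x y z xT yT zT xy yz pxz.
  apply/existsP; exists [set x; y; z].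
  have [/andP[x_y nxy] /andP[y_z nyz] /andP[x_z nxz]] := And3 xy yz xz.
  apply/and3P; split; first by rewrite !subUset !sub1set xT yT.
    by apply/stableP => s t; rewrite !inE -!orbA => /or3P[] /eqP->
      /or3P[] /eqP->; rewrite ?adj_irr // adj_sym.
  by rewrite -setUA !cardsU1 cards1 !inE negb_or x_y x_z y_z.
have [clT|nclT] := boolP (is_clique T).
  exact: set_colorable_leq (le_m T _ clT) (set_colorable_card T).
have [x [y [xT yT xy]]] : exists x y, [/\ x \in T, y \in T & apart x y].
  move: nclT; rewrite /is_clique => /forall_inPn[x xT /forall_inPn[y yT]].
  by rewrite negb_imply; exists x, y.
(* Without a stable triple, a vertex having a non-neighbour in one part is
   adjacent to all the other parts.  The vertices of the parts of x and y that
   have a non-neighbour in the other of these two parts are therefore adjacent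
   to all the other vertices of T. *)
pose side a b := [set u in T | (p u == p a) &&
  [exists w in T, (p w == p b) && apart u w]].
pose X := side x y; pose Y := side y x; pose R := T :\: (X :|: Y).
have sideT a b : side a b \subset T.
  by apply/subsetP => u; rewrite inE => /andP[].
have side_clique a b : is_clique (side a b).
  apply/cliqueP => u w; rewrite !inE.
  move=> /and3P[uT /eqP pu _] /and3P[wT /eqP pw _].
  by move=> uw; apply: apart_p; rewrite ?pu ?pw.
have pxy : p x != p y by apply: parts.
have side_join a b u r : p a != p b -> u \in side a b -> r \in T ->
    r \notin side a b -> r \notin side b a -> adj u r.
  move=> pab /[dup] uab; rewrite inE => /and3P[uT /eqP pu /exists_inP[w wT]].
  move=> /andP[/eqP pw uw] rT rNab rNba; apply: contraT => nur.
  have ur : apart u r by rewrite /apart nur andbT; apply: contraNneq rNab => <-.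
  have pwr : p w = p r by apply: (no3 w u r) => //; rewrite apart_sym.
  move: rNba; rewrite inE rT -pwr pw eqxx /= => /exists_inPn/(_ u uT).
  by rewrite pu eqxx apart_sym ur.
have xX : x \in X.
  by rewrite inE xT eqxx; apply/exists_inP; exists y; rewrite // eqxx.
have XYT : X :|: Y \subset T by rewrite subUset !sideT.
have TE : (X :|: Y) :|: R = T.
  by rewrite -[RHS](setID T (X :|: Y)) (setIidPr XYT).
rewrite -TE in le_m *; apply: set_colorable_join => //.
- move=> u r; rewrite !inE => uXY /andP[]; rewrite negb_or => /andP[rX rY] rT.
  by case/orP: uXY => [uX|uY]; [apply: (side_join x y)|apply: (side_join y x)];
    rewrite // 1?eq_sym // inE.
- by move=> k; apply: Konig; apply: side_clique.
move=> k; apply: IH; rewrite properEneq subsetDl andbT.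
by apply: contraTneq xT => <-; rewrite in_setD in_setU xX.
Qed.

End PerfectPieces.

(** * The neighbourhood and the non-neighbourhood of a largest star *)

Section CrownForkFree.

Variable G : sgraph.
Hypothesis crown_free : is_free crown G.
Hypothesis fork_free : is_free fork G.
Implicit Types (A B K Q S T U I : {set G}) (u v w x y z : G).

Lemma stable_apart I x y : stable I ->
  x \in I -> y \in I -> x != y -> apart x y.
Proof. by move=> /stableP stI xI yI xy; rewrite /apart xy stI. Qed.

Definition star A v I :=
  [&& v \in A, I \subset A, stable I & [forall i in I, adj v i]].

Lemma starP A v I : reflect [/\ v \in A, I \subset A, stable I &
  {in I, forall i, adj v i}] (star A v I).
Proof.
by apply: (iffP and4P) => -[? ? ? /forall_inP ?]; split=> //; apply/forall_inP.
Qed.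

(** Three elements of I, together with u and v, would form a crown. *)
Lemma common_stable u v I : adj u v -> stable I ->
  {in I, forall i, adj u i} -> {in I, forall i, adj v i} -> #|I| <= 2.
Proof.
move=> uv stI uI vI; rewrite leqNgt; apply/negP => /card_gt2P[a [b [c]]].
move=> [[aI bI cI] [ab bc ca]].
have st := stable_apart stI.
by apply: (no_crown crown_free uv (uI a aI) (uI b bI) (uI c cI)
  (vI a aI) (vI b bI) (vI c cI)); apply: st; rewrite // eq_sym.
Qed.

(** The neighbourhood of u has no stable triple, so u has fewer neighbours
    than there are colours. *)
Lemma clawless_colorable A u m : u \in A -> cliques_le A m ->
  (forall I, star A u I -> #|I| <= 2) ->
  set_colorable (A :\ u) 'C(m.+1, 2) -> set_colorable A 'C(m.+1, 2).
Proof.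
move=> uA le_m no_star; apply: set_colorable_small_degree => //.
case: m le_m => [|m] le_m.
  by have := le_m _ _ (clique1 u); rewrite sub1set uA cards1 => /(_ isT).
apply: Ramsey3 => [I /subsetP IN stI|Q /subsetP QN clQ].
  apply: no_star; apply/starP; split=> // [|i /IN];
    last by rewrite inE => /andP[].
  by apply/subsetP => i /IN; rewrite inE => /andP[].
have uQ : u \notin Q by apply/negP => /QN; rewrite inE adj_irr andbF.
suff: #|u |: Q| <= m.+1 by rewrite cardsU1 uQ.
apply: le_m.
  rewrite subUset sub1set uA; apply/subsetP => x /QN.
  by rewrite inE => /andP[].
apply: cliqueU => // [|x y /set1P-> /QN]; first exact: clique1.
by rewrite inE => /andP[].
Qed.

Section MaximumStar.

Variables (A : {set G}) (v : G) (I : {set G}).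
Hypothesis starI : star A v I.
Hypothesis I_gt2 : 2 < #|I|.
Hypothesis maxI : forall u J, star A u J -> #|J| <= #|I|.

Let vA : v \in A. Proof. by case/starP: starI. Qed.
Let IA : I \subset A. Proof. by case/starP: starI. Qed.
Let stI : stable I. Proof. by case/starP: starI. Qed.
Let vI i : i \in I -> adj v i. Proof. by case/starP: starI => _ _ _; apply. Qed.
Let I_apart i j : i \in I -> j \in I -> i != j -> apart i j.
Proof. exact: stable_apart stI. Qed.

Definition far := [set x in A | ~~ adj v x].
Definition missed x := [set i in I | ~~ adj x i].

Lemma in_missed x i : i \in I -> (i \in missed x) = ~~ adj x i.
Proof. by rewrite inE => ->. Qed.

Lemma other_leaf (i j : G) : exists2 l, l \in I & (l != i) && (l != j).
Proof.
have /subsetPn[l lI] : ~~ (I \subset [set i; j]).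
  apply: contraL I_gt2 => /subset_leq_card; rewrite -leqNgt => /leq_trans-> //.
  by rewrite cards2; case: (_ != _).
by rewrite !inE negb_or; exists l.
Qed.

Lemma two_hit x : #|missed x| <= 1 ->
  exists i j, [/\ i \in I, j \in I, i != j, adj x i & adj x j].
Proof.
move=> le1; have : 1 < #|I :\: missed x|.
  have := cardsID (missed x) I.
  rewrite (setIidPr _); last by apply/subsetP => i; rewrite inE => /andP[].
  by move: I_gt2 le1; clear; lia.
move=> /card_gt1P[i [j]]; rewrite !inE => -[/andP[hi iI] /andP[hj jI] ij].
by exists i, j; move: hi hj; rewrite iI jI !negbK.
Qed.

(** A leaf adjacent to x and two missed leaves, together with v and x, form a
    fork. *)
Lemma far_missed x : x \in far -> missed x != I -> #|missed x| <= 1.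
Proof.
rewrite inE => /andP[xA nvx] nI; rewrite leqNgt; apply/negP => /card_gt1P.
move=> [i [j]]; rewrite !inE => -[/andP[iI nxi] /andP[jI nxj] ij].
have [a aI xa] : exists2 a, a \in I & adj x a.
  apply/exists_inP; apply: contraNT nI => /exists_inPn noa.
  apply/eqP/setP => a; rewrite inE; case: (boolP (a \in I)) => //.
  exact: noa.
have ai : a != i by apply: contraNneq nxi => <-.
have aj : a != j by apply: contraNneq nxj => <-.
by apply: (no_fork fork_free (vI aI) (vI iI) (vI jI) (I_apart aI iI ai)
  (I_apart aI jI aj) (I_apart iI jI ij) nvx); rewrite 1?adj_sym.
Qed.

Definition remote := [set x in far | missed x == I].
Definition near_miss := [set x in far | #|missed x| == 1].

Lemma remoteP x : reflect
  [/\ x \in A, ~~ adj v x & {in I, forall i, ~~ adj x i}]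
  (x \in remote).
Proof.
rewrite !inE -andbA; apply: (iffP and3P) => -[-> ->].
  by move=> /eqP xI; split=> // i; rewrite -{1}xI inE => /andP[].
move=> xI; split=> //; apply/eqP/setP => i; rewrite inE.
by case: (boolP (i \in I)) => // /xI->.
Qed.

Lemma remote_notin c : c \in remote -> c \notin I.
Proof. by case/remoteP => _ nvc _; apply: contra nvc; apply: vI. Qed.

(** For a neighbour y of v, the edge from y to c is the long branch of a fork
    centred at v, with two leaves missed by y as short branches. *)
Lemma remote_nbr_missed c y : c \in remote -> y \in A -> y \notin remote ->
  adj y c -> #|missed y| <= 1.
Proof.
move=> cR yA yNR yc; have [cA nvc ncI] := remoteP _ cR.
have [vy|nvy] := boolP (adj v y); last first.
  have yF : y \in far by rewrite inE yA.
  by apply: far_missed => //; apply: contra yNR => yI; rewrite inE yF.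
have yI : y \notin I by apply: contraL yc => /ncI; rewrite adj_sym.
rewrite leqNgt; apply/negP => /card_gt1P[i [j]]; rewrite !inE.
move=> [/andP[iI nyi] /andP[jI nyj] ij].
have y_apart k : k \in I -> ~~ adj y k -> apart y k.
  by move=> kI nyk; rewrite /apart nyk andbT; apply: contraNneq yI => ->.
apply: (no_fork fork_free vy (vI iI) (vI jI) (y_apart i iI nyi)
  (y_apart j jI nyj) (I_apart iI jI ij) nvc yc);
  by rewrite adj_sym ncI.
Qed.

(** If y is not adjacent to c', then y is the centre of a fork whose long
    branch is y, c, c' and whose short branches are two leaves adjacent to y. *)
Lemma remote_twins c c' y : c \in remote -> c' \in remote -> adj c c' ->
  y \in A -> y \notin remote -> adj y c -> adj y c'.
Proof.
move=> cR c'R cc' yA yNR yc.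
have [i [j [iI jI ij yi yj]]] := two_hit (remote_nbr_missed cR yA yNR yc).
have [_ _ ncI] := remoteP _ cR; have [_ _ nc'I] := remoteP _ c'R.
have c_apart k : k \in I -> apart c k.
  move=> kI; rewrite /apart ncI // andbT.
  by apply: contraNneq (remote_notin cR) => ->.
apply: contraT => nyc'.
by case: (no_fork fork_free yc yi yj (c_apart i iI) (c_apart j jI)
  (I_apart iI jI ij) nyc' cc'); rewrite adj_sym nc'I.
Qed.

Definition cut_off :=
  [set c in remote | [forall y in A, adj c y ==> (y \in remote)]].

Hypothesis claws : forall u, u \in A -> exists2 J, star A u J & 2 < #|J|.

(** Let J be the leaves of a claw centred at c.  If J contained both a remote
    leaf and a leaf that is not, the two would be adjacent, by
    [remote_twins].  If no element of J is remote, they are all adjacent to c'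
    too, so that c and c' are the two dominating vertices of a crown.  If all
    of them are remote, any neighbour of c that is not remote forms a crown
    with c and J. *)
Lemma remote_edge_cut_off c c' : c \in remote -> c' \in remote -> adj c c' ->
  c \in cut_off.
Proof.
move=> cR c'R cc'; rewrite inE cR /=; have [cA _ _] := remoteP _ cR.
have [J /starP[_ /subsetP JA stJ cJ] J_gt2] := claws cA.
have [JR|/subsetPn[l lJ lNR]] := boolP (J \subset remote).
  apply/forall_inP => y yA; apply/implyP => cy; apply: contraT => yNR.
  suff: #|J| <= 2 by rewrite leqNgt J_gt2.
  apply: (common_stable cy) => // i iJ.
  by apply: (remote_twins cR _ (cJ i iJ) yA yNR);
    rewrite ?(subsetP JR) // adj_sym.
suff: #|J| <= 2 by rewrite leqNgt J_gt2.
apply: (common_stable cc') => // i iJ.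
have [iR|iNR] := boolP (i \in remote); last first.
  by rewrite adj_sym; apply: remote_twins cc' _ iNR _;
    rewrite // ?JA // adj_sym cJ.
have := remote_twins cR iR (cJ i iJ) (JA l lJ) lNR.
rewrite adj_sym cJ // => /(_ isT) li.
by move/stableP: stJ => /(_ l i lJ iJ); rewrite li.
Qed.

(** Hence [cut_off] is a union of connected components of A. *)
Lemma cut_off_closed c x : c \in cut_off -> x \in A -> adj c x -> x \in cut_off.
Proof.
rewrite inE => /andP[cR /forall_inP out] xA cx.
have /implyP/(_ cx) xR := out x xA.
by apply: (remote_edge_cut_off xR cR); rewrite adj_sym.
Qed.

Lemma near_missP x : x \in near_miss -> exists i,
  [/\ i \in I, missed x = [set i], ~~ adj x i
    & {in I, forall j, j != i -> adj x j}].
Proof.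
rewrite inE => /andP[_ /cards1P[i xi]]; exists i.
have : i \in missed x by rewrite xi set11.
rewrite inE => /andP[iI nxi]; split=> // j jI ji.
by have := in_missed x jI; rewrite xi inE (negPf ji) => /esym/negbFE.
Qed.

Lemma far_nadj x : x \in far -> ~~ adj v x.
Proof. by rewrite inE => /andP[]. Qed.

Lemma near_far x : x \in near_miss -> x \in far.
Proof. by rewrite inE => /andP[]. Qed.

(** The vertices x, v and y are the leaves of a claw centred at l.  A vertex
    z adjacent to neither l nor v cannot be adjacent to exactly one of x and y,
    since this would make a fork. *)
Lemma both_or_neither l x y z : l \in I ->
  adj x l -> adj y l -> apart v x -> apart v y ->
  apart x y -> ~~ adj z l -> ~~ adj v z -> adj x z -> adj y z.
Proof.
move=> lI xl yl vx vy xy nzl nvz xz; apply: contraT => nyz.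
have lv : adj l v by rewrite adj_sym vI.
by case: (no_fork (a := x) (b := v) (c := y) (d := z) fork_free (v := l));
  rewrite // 1?adj_sym // apart_sym.
Qed.

Lemma near_apart_v x : x \in near_miss -> apart v x.
Proof.
move=> xT; rewrite /apart far_nadj ?near_far // andbT.
have [i [iI _ nxi _]] := near_missP xT.
by apply: contraNneq nxi => <-; apply: vI.
Qed.

(** If non-adjacent x and y both miss the leaf i only, another leaf l is the
    centre of a fork with short branches x and y and long branch l, v, i. *)
Lemma near_parts : {in near_miss &,
  forall x y, apart x y -> missed x != missed y}.
Proof.
move=> x y xT yT xy; apply/negP => /eqP.
have [i [iI -> nxi xI]] := near_missP xT.
have [j [jI -> nyj yI]] := near_missP yT.
move=> /set1_inj ij; rewrite -{j}ij in jI nyj yI.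
have [l lI /andP[li _]] := other_leaf i i.
have lv : adj l v by rewrite adj_sym vI.
have il : ~~ adj l i by have /andP[] := I_apart lI iI li.
case: (no_fork (a := v) (b := x) (c := y) (d := i) fork_free (v := l)) => //.
- by rewrite adj_sym xI.
- by rewrite adj_sym yI.
- exact: near_apart_v.
- exact: near_apart_v.
exact: vI.
Qed.

(** This is [both_or_neither] at the leaf missed by z. *)
Lemma near_trans : {in near_miss & &, forall x y z,
  apart x y -> apart y z -> missed x != missed z -> apart x z}.
Proof.
move=> x y z xT yT zT xy yz xz.
have := near_parts yT zT yz; have := near_parts xT yT xy; move: xz.
have [i [iI -> nxi xI]] := near_missP xT.
have [j [jI -> nyj yI]] := near_missP yT.
have [k [kI -> nzk zI]] := near_missP zT.
rewrite !(inj_eq set1_inj) => ik ij jk.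
rewrite /apart; apply/andP; split.
  by apply: contraNneq nxi => ->; apply: zI.
have /andP[_] := yz; apply: contra => xz.
by apply: (both_or_neither kI _ _ _ _ xy _ _ xz);
  rewrite ?near_apart_v ?far_nadj ?near_far
  ?xI ?yI // eq_sym.
Qed.

(** For a remote z this is [both_or_neither] at a leaf missed by neither x nor
    y.  Otherwise z is adjacent to all of I; if it is not adjacent to y, then
    v, z and y are the leaves of a claw centred at the leaf i missed by x, and
    x would be adjacent to z only. *)
Lemma rest_agree z x y : z \in far :\: near_miss -> x \in near_miss ->
  y \in near_miss -> apart x y -> adj z x -> adj z y.
Proof.
move=> /setDP[zF zNT] xT yT xy zx.
have nvz := far_nadj zF.
have := near_parts xT yT xy.
have [i [iI -> nxi xI]] := near_missP xT.
have [j [jI -> nyj yI]] := near_missP yT.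
rewrite (inj_eq set1_inj) => ij.
have [zI|zI] := eqVneq (missed z) I.
  have [l lI /andP[li lj]] := other_leaf i j.
  have nzl : ~~ adj z l by rewrite -in_missed // zI.
  rewrite adj_sym; apply: (both_or_neither lI _ _ _ _ xy nzl nvz _);
    rewrite ?near_apart_v //.
  - exact: xI.
  - exact: yI.
  by rewrite adj_sym.
have z0 : missed z = set0.
  apply/eqP; have := far_missed zF zI.
  rewrite leq_eqVlt ltnS leqn0 cards_eq0 => /predU1P[z1|//].
  by rewrite inE zF z1 in zNT.
have zall l : l \in I -> adj z l.
  by move=> lI; rewrite -[adj z l]negbK -in_missed // z0 inE.
apply: contraT => nzy.
have zy : apart z y.
  by rewrite /apart nzy andbT; apply: contraNneq zNT => ->.
have vz : apart v z.
  rewrite /apart nvz andbT; apply: contraTneq zx => <-.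
  exact: far_nadj (near_far xT).
have := @both_or_neither i z y x iI.
rewrite zall // yI // 1?eq_sym // => /(_ isT isT vz).
rewrite near_apart_v // zy nxi far_nadj ?near_far // zx.
move=> /(_ isT isT isT isT isT).
by have /andP[_] := xy; rewrite adj_sym => /negPf->.
Qed.

(** A remote vertex adjacent to a vertex that is complete to I would enlarge
    the star, and two adjacent vertices complete to I would form a crown. *)
Lemma rest_stable : stable remote -> stable (far :\: near_miss).
Proof.
move=> /stableP stR.
have restE z : z \in far :\: near_miss ->
    z \in remote \/ {in I, forall i, adj z i}.
  move=> /setDP[zF zNT]; have [zI|zI] := eqVneq (missed z) I.
    by left; rewrite inE zF zI eqxx.
  right=> i iI; have := far_missed zF zI.
  rewrite leq_eqVlt ltnS leqn0 cards_eq0 => /predU1P[z1|/eqP z0].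
    by rewrite inE zF z1 in zNT.
  by rewrite -[adj z i]negbK -in_missed // z0 inE.
have inA z : z \in far :\: near_miss -> z \in A by rewrite !inE => /and3P[].
have full_remote x c : x \in A -> {in I, forall i, adj x i} -> c \in remote ->
    ~~ adj x c.
  move=> xA xI cR; apply/negP => xc; have [cA _ ncI] := remoteP _ cR.
  suff /maxI : star A x (c |: I) by rewrite cardsU1 remote_notin // ltnn.
  apply/starP; split=> //; first by rewrite subUset sub1set cA.
    apply/stableP => i j /setU1P[->|iI] /setU1P[->|jI].
    - by rewrite adj_irr.
    - exact: ncI.
    - by rewrite adj_sym ncI.
    by move/stableP: stI; apply.
  by move=> i /setU1P[->|]; [|apply: xI].
apply/stableP => x y xZ yZ.
case: (restE x xZ) (restE y yZ) => [xR|xI] [yR|yI].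
- exact: stR.
- by rewrite adj_sym full_remote // inA.
- by rewrite full_remote // inA.
apply/negP => xy; have := common_stable xy stI xI yI.
by rewrite leqNgt I_gt2.
Qed.

(** The colour given to z outside [near_miss] is the one of a non-neighbour of
    z in a largest clique Q of [near_miss], or else the number #|Q|, the first
    one that is not used on [near_miss]. *)
Lemma far_colorable m : stable remote -> cliques_le A m -> set_colorable far m.
Proof.
move=> stR le_m.
have TF : near_miss \subset far by apply/subsetP => x /near_far.
have FA : far \subset A by apply/subsetP => x; rewrite inE => /andP[].
have TA := subset_trans TF FA.
have [Q [clQ QT] maxQ] := maximum_clique near_miss.
have [c [c_lt c_adj]] := set_colorable_parts near_parts near_trans maxQ.
rewrite -(setID far near_miss) (setIidPr TF).
apply: (set_colorable_extend (c := c)) => //.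
- move=> x /c_lt xQ; apply: leq_trans xQ _.
  by apply: le_m => //; apply: subset_trans TA.
- exact: rest_stable.
move=> z zZ; have [zQ|/forall_inPn[w wQ nzw]] := boolP [forall w in Q, adj z w].
  exists #|Q|; last by move=> x /c_lt xQ _; rewrite neq_ltn xQ.
  have zNQ : z \notin Q.
    by apply/negP => zinQ; move/forall_inP/(_ z zinQ): zQ; rewrite adj_irr.
  suff: #|z |: Q| <= m by rewrite cardsU1 zNQ.
  have /setDP[zF _] := zZ.
  apply: le_m; first by rewrite subUset sub1set (subsetP FA) //
    (subset_trans QT).
  apply: cliqueU => // [|x y /set1P-> yQ _]; first exact: clique1.
  by move/forall_inP: zQ; apply.
have wT := subsetP QT w wQ.
exists (c w).
  by apply: leq_trans (c_lt w wT) _; apply: le_m => //; apply: subset_trans TA.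
move=> x xT zx; apply: c_adj => //; apply: contraT => nxw.
have xw : apart x w.
  by rewrite /apart nxw andbT; apply: contraNneq nzw => <-.
by rewrite (rest_agree zZ xT wT xw zx) in nzw.
Qed.

End MaximumStar.

Lemma crown_fork_free_colorable m A : cliques_le A m ->
  set_colorable A 'C(m.+1, 2).
Proof.
elim: m A => [|m IHm] A le_m.
  suff -> : A = set0 by exists (fun=> 0); split=> x; rewrite inE.
  apply/setP => x; rewrite inE; apply/negP => xA.
  by have := le_m _ _ (clique1 x); rewrite sub1set xA cards1 => /(_ isT).
have [n] := ubnP #|A|; elim: n A le_m => // n IHn A le_m; rewrite ltnS => le_n.
have IH B : B \proper A -> set_colorable B 'C(m.+2, 2).
  move=> BA; apply: IHn; first exact: cliques_leS (proper_sub BA) le_m.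
  exact: leq_trans (proper_card BA) le_n.
have [->|[u0 u0A]] := set_0Vmem A.
  by exists (fun=> 0); split=> x; rewrite inE.
have [/exists_inP[u uA /forallP noJ]|claws] :=
  boolP [exists u in A, forall J : {set G}, star A u J ==> (#|J| <= 2)].
  apply: clawless_colorable (uA) le_m _ (IH _ (properD1 uA)) => J.
  exact/implyP.
have {}claws u : u \in A -> exists2 J, star A u J & 2 < #|J|.
  move: claws => /exists_inPn/(_ u) h /h /forallPn[J].
  by rewrite negb_imply -ltnNge => /andP[]; exists J.
have [J0 starJ0 J0_gt2] := claws u0 u0A.
pose P (p : G * {set G}) := star A p.1 p.2.
case: (@arg_maxnP _ (u0, J0) P (fun p => #|p.2|) starJ0) => -[v I] starI maxI.
have I_gt2 : 2 < #|I| := leq_trans J0_gt2 (maxI (u0, J0) starJ0).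
have {}maxI u J : star A u J -> #|J| <= #|I| by move/(maxI (u, J)).
have [vA _ _ vI] := starP _ _ _ starI.
have [stR|] := boolP (stable (remote A v I)).
  rewrite -(setID A [set x in A | adj v x]) binS bin1.
  apply: set_colorableU.
    apply: IHm => Q /subsetIP[QA /subsetP QN] clQ.
    have vQ : v \notin Q by apply/negP => /QN; rewrite inE adj_irr andbF.
    suff: #|v |: Q| <= m.+1 by rewrite cardsU1 vQ.
    apply: le_m; first by rewrite subUset sub1set vA.
    apply: cliqueU => // [|x y /set1P-> /QN]; first exact: clique1.
    by rewrite inE => /andP[].
  apply: set_colorableS (far_colorable starI I_gt2 maxI stR le_m).
  by apply/subsetP => x; rewrite !inE; case: (x \in A); case: (adj v x).
move=> /forall_inPn[c cR /forall_inPn[c' c'R]]; rewrite negbK => cc'.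
have cW := remote_edge_cut_off starI I_gt2 claws cR c'R cc'.
have WA : cut_off A v I \subset A.
  by apply/subsetP => x; rewrite !inE => /andP[/andP[/andP[]]].
rewrite -(setID A (cut_off A v I)) (setIidPr WA).
apply: set_colorable_disconnected.
- move=> x y xW /setDP[yA yNW]; apply: contra yNW.
  exact: (cut_off_closed starI I_gt2 claws).
- apply: IH; rewrite properEneq WA andbT; apply: contraTneq vA => <-.
  apply/negP; rewrite inE => /andP[/remoteP[_ _ vnI] _].
  have /card_gt0P[i iI] : 0 < #|I| by apply: leq_trans I_gt2.
  by have := vnI i iI; rewrite vI.
apply: IH; rewrite properEneq subsetDl andbT.
apply: contraTneq (subsetP WA c cW) => <-.
by rewrite in_setD cW.
Qed.

End CrownForkFree.

Lemma chromatic_number_le (G : sgraph) k : set_colorable [set: G] k ->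
  chromatic_number G <= k.
Proof.
move=> [c [c_lt c_adj]]; rewrite /chromatic_number.
case: ex_minnP => n _; apply.
have lt x : c x < k by apply: c_lt.
apply/existsP; exists [ffun x => Ordinal (lt x)].
apply/forallP => x; apply/forallP => y; apply/implyP => xy.
by rewrite !ffunE -val_eqE /= c_adj.
Qed.

Local Open Scope ring_scope.

Theorem corollary1p2 (G : sgraph) (crown_free : is_free crown G)
    (fork_free : is_free fork G) :
  (chromatic_number G)%:R <=
    1 / 2 * ((clique_number G)%:R ^+ 2 + (clique_number G)%:R) :> rat.
Proof.
set w := clique_number G.
have le_w : cliques_le [set: G] w.
  by move=> Q _ clQ; rewrite /w /clique_number (bigD1 Q) //= leq_maxl.
have := chromatic_number_le
  (crown_fork_free_colorable crown_free fork_free le_w).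
rewrite -(ler_nat rat) => /le_trans-> //.
rewrite mul1r mulrC ler_pdivlMr ?ltr0n // -natrX -natrD -natrM ler_nat.
by rewrite mulnC -mul_bin_diag bin1 mulSn addnC.
Qed.
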